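(* In the known-preferences setting, for any $\delta>0$, the approximation ratio of any Random-Median mechanism is at least $4/3-\delta$.
   Context: Setting: a finite nonempty set $N$ of $n$ agents and two facilities $1,2$. Agent $i$ has a position $x_i\in[0,1]$ and an approval preference $t_i=(t_{i1},t_{i2})\in\{0,1\}^2$ ($t_{ij}=1$ iff $i$ approves facility $j$); every agent approves at least one facility. An instance is $I=(\mathbf{x},\mathbf{t})$. If facility $j$ is located at $y\in[0,1]$ (a single facility is located), agent $i$ has utility $u_i(j,y|I)=t_{ij}(1-|x_i-y|)$; the social welfare is $W(j,y|I)=\sum_{i\in N}u_i(j,y|I)$ and $W^*(I)=\max_{(j,y)}W(j,y|I)$. A randomized mechanism maps each instance to a probability distribution over outcomes $(j,y)\in\{1,2\}\times[0,1]$. The approximation ratio of a mechanism $M$ is $\rho(M)=\sup_I W^*(I)/W(M(I)|I)$ over all instances (with any number of agents), where $W(M(I)|I)$ is the expected social welfare. In the known-preferences setting preferences are public and agents can misreport only positions. A Random-Median mechanism first randomly chooses one of the two facilities according to a probability distribution that depends only on the preferences of the agents (not on their positions), and then locates the chosen facility at the position of the median agent among the agents that approve it (if their number is even, a fixed one of the two middle agents in the order of positions; if nobody approves it, at an arbitrary fixed location). Different choices of the probability distribution give different Random-Median mechanisms. *)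

(* Defs.v *)
From mathcomp Require Import all_boot all_order all_algebra.
From mathcomp Require Import all_classical all_reals all_analysis.

Set Implicit Arguments.
Unset Strict Implicit.
Unset Printing Implicit Defensive.

Import Order.TTheory GRing.Theory Num.Theory.

Local Open Scope classical_set_scope.
Local Open Scope ring_scope.

(* [false] is facility 1 and [true] is facility 2; a notation rather than a
   definition, so that the (discrete) measurable structure of [bool] is found. *)
Notation facility := bool.

Definition profile (n : nat) := 'I_n -> facility -> bool.

(* The agents are the elements of 'I_n; [prefs i j] is t_ij. *)
Record instance (R : realType) (n : nat) := Instance {
  agents_gt0 : (0 < n)%N;
  pos : 'I_n -> R;
  prefs : profile n;
  pos_itv : forall i, 0 <= pos i <= 1;
  prefs_ex : forall i, exists j, prefs i j }.

Definition utility (R : realType) (n : nat) (I : instance R n) (i : 'I_n)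
    (j : facility) (y : R) : R :=
  (prefs I i j)%:R * (1 - `|pos I i - y|).

Definition welfare (R : realType) (n : nat) (I : instance R n)
    (j : facility) (y : R) : R :=
  \sum_(i < n) utility I i j y.

(* This supremum is a maximum: there are two facilities, and the welfare is
   continuous in the location on the compact [0, 1]. *)
Definition opt_welfare (R : realType) (n : nat) (I : instance R n) : R :=
  sup [set w | exists j : facility, exists2 y : R,
                 0 <= y <= 1 & w = welfare I j y].

(* Lotteries over {1, 2} x [0, 1] are represented as probability measures on
   {1, 2} x R that give mass 1 to {1, 2} x [0, 1]. *)
Record mechanism (R : realType) := Mechanism {
  lottery :> forall n, instance R n -> probability (facility * R)%type R;
  lottery_supp : forall n (I : instance R n),
    lottery I ([set: facility] `*` `[0, 1]) = 1%E }.

Arguments lottery {R} m {n} I.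

Definition expected_welfare (R : realType) (M : mechanism R) (n : nat)
    (I : instance R n) : \bar R :=
  ('E_(lottery M I)[(fun o : facility * R => welfare I o.1 o.2)])%E.

(* Since [0^-1 = +oo] in [\bar R] and the optimal welfare is positive, an
   instance on which the expected welfare is 0 has ratio [+oo]. *)
Definition approx_ratio (R : realType) (M : mechanism R) : \bar R :=
  ereal_sup [set r | exists n, exists I : instance R n,
               r = ((opt_welfare I)%:E / expected_welfare M I)%E].

Definition approver_positions (R : realType) (n : nat) (I : instance R n)
    (j : facility) : seq R :=
  sort <=%O [seq pos I i | i <- enum 'I_n & prefs I i j].

(* With m approving agents, the (0-based) index m./2 is the median for odd m
   and the right one of the two middle agents for even m > 0, while (m - 1)./2
   is the median for odd m and the left middle agent for even m > 0.  For
   m = 0, [nth] returns the default location [d]. *)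
Definition median_location (R : realType) (right : bool) (d : R) (n : nat)
    (I : instance R n) (j : facility) : R :=
  let s := approver_positions I j in
  nth d s (if right then (size s)./2 else (size s).-1./2).

(* [p] is the distribution of the facility, which sees only the preferences;
   [right] is the fixed choice among two middle agents and [d] the fixed
   location of a facility that nobody approves. *)
Definition random_median (R : realType) (M : mechanism R) : Prop :=
  exists (p : forall n, profile n -> probability facility R)
         (right : facility -> bool) (d : facility -> R),
    (forall j, 0 <= d j <= 1) /\
    forall n (I : instance R n) (A : set (facility * R)),
      measurable A ->
      lottery M I A =
      pushforward (p n (prefs I))
        (fun j => (j, median_location (right j) (d j) I j)) A.

(* Main.v *)
Require Import Defs.
From mathcomp Require Import all_boot all_order all_algebra.
From mathcomp Require Import all_classical all_reals all_analysis.
From mathcomp Require Import ring lra.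

(** Two agents approve only facility 1 and two others only facility 2; some
    facility [b] is chosen with probability [q >= 1/2] on this profile.  Put the
    two approvers of [b] at the two ends of the interval and the two other
    agents at one point.  Wherever [b] is located its welfare is 1, while the
    other facility has welfare at most 2, which it attains, so the expected
    welfare is at most [q + 2 (1 - q) <= 3/2] against an optimum of 2.  Only the
    law of the chosen facility matters, not the median rule. *)

Import Order.TTheory GRing.Theory Num.Theory.

Import measurable_realfun.

Local Open Scope classical_set_scope.
Local Open Scope ring_scope.

Lemma utility_ge0 (R : realType) n (I : instance R n) i j y :
  0 <= y <= 1 -> 0 <= utility I i j y.
Proof.
move=> /andP[y0 y1]; rewrite /utility mulr_ge0 // subr_ge0 ler_norml.
by have /andP[x0 x1] := pos_itv I i; apply/andP; split; lra.
Qed.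

Lemma utility_le1 (R : realType) n (I : instance R n) i j y :
  utility I i j y <= 1.
Proof.
rewrite /utility; have := normr_ge0 (pos I i - y).
by case: (prefs I i j) => /= ?; rewrite ?mul1r ?mul0r; lra.
Qed.

Lemma welfare_ge0 (R : realType) n (I : instance R n) j y :
  0 <= y <= 1 -> 0 <= welfare I j y.
Proof. by move=> y01; apply: sumr_ge0 => i _; exact: utility_ge0. Qed.

Lemma welfare_le_opt (R : realType) n (I : instance R n) j y :
  0 <= y <= 1 -> welfare I j y <= opt_welfare I.
Proof.
move=> y01; apply: ub_le_sup; last by exists j, y.
(* The [sup] is only meaningful on a set bounded above; [n] agents of utility at most 1 give the
   bound. *)
exists n%:R => _ [k [z _ ->]].
rewrite /welfare -[in leRHS](card_ord n) -sumr_const.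
by apply: ler_sum => i _; exact: utility_le1.
Qed.

Lemma measurable_welfare (R : realType) n (I : instance R n) :
  measurable_fun [set: facility * R] (fun o => welfare I o.1 o.2).
Proof.
rewrite /welfare; apply: measurable_sum => i; apply: measurable_funM.
  have mt : measurable_fun [set: facility] (fun j => (prefs I i j)%:R : R).
    by [].
  exact: (measurableT_comp mt).
apply: measurable_funB => //; apply: measurableT_comp => //.
exact: measurable_funB.
Qed.

(** The complement of the strip is a null set of the lottery. Welfare can be negative there, so the
    restriction is what makes the integration lemmas for nonnegative functions applicable. *)
Lemma expected_welfareE (R : realType) (M : mechanism R) n (I : instance R n) :
  expected_welfare M I =
  (\int[lottery M I]_(o in [set: facility] `*` `[0%R, 1%R])
     (welfare I o.1 o.2)%:E)%E.
Proof.
have mD : measurable ([set: facility] `*` `[0%R, 1%R] : set (facility * R)).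
  exact: measurableX.
have mW : measurable_fun setT (EFin \o (fun o => welfare I o.1 o.2)).
  by apply/measurable_EFinP; exact: measurable_welfare.
rewrite /expected_welfare unlock [RHS]integral_mkcond.
apply: ae_eq_integral => //.
  by apply/(measurable_restrictT _ mD); exact: measurable_funTS.
exists (~` ([set: facility] `*` `[0, 1])); split.
- exact: measurableC.
- by rewrite [LHS](probability_setC (lottery M I) mD) lottery_supp subee.
- by move=> o /= fo Do; apply: fo => _; rewrite patchE mem_set.
Qed.

Lemma expected_welfare_ge0 (R : realType) (M : mechanism R) n
    (I : instance R n) : (0 <= expected_welfare M I)%E.
Proof.
rewrite expected_welfareE; apply: integral_ge0 => o [_ /=].
by rewrite in_itv /= lee_fin => /welfare_ge0.
Qed.

(** Since [h] ignores the location, integrating over the strip of each facility leaves only the mass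
    of that strip. *)
Lemma expected_welfare_le (R : realType) (M : mechanism R) n
    (I : instance R n) (h : facility -> R) (b : facility) :
  (forall j y, 0 <= y <= 1 -> welfare I j y <= h j) ->
  (expected_welfare M I <=
   (h b)%:E * lottery M I ([set b] `*` `[0%R, 1%R]) +
   (h (~~ b))%:E * lottery M I ([set ~~ b] `*` `[0%R, 1%R]))%E.
Proof.
move=> Wh.
have mX j : measurable ([set j] `*` `[0%R, 1%R] : set (facility * R)).
  exact: measurableX.
have mW D : measurable_fun D (EFin \o (fun o => welfare I o.1 o.2)).
  by apply/measurable_funTS/measurable_EFinP; exact: measurable_welfare.
rewrite expected_welfareE.
have -> : [set: facility] `*` `[0%R, 1%R] =
          ([set b] `*` `[0%R, 1%R]) `|` ([set ~~ b] `*` `[0%R, 1%R])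
          :> set (facility * R).
  apply/seteqP; split=> -[j y] /=; last by case=> -[].
  by case=> _ ?; case: (b); case: j; [left|right|right|left].
rewrite ge0_integral_setU //; first last.
- by apply/disj_setPS => -[j y] /= [[-> _] [/eqP]]; case: (b).
- by move=> o; case=> -[_ /=]; rewrite in_itv /= lee_fin => /welfare_ge0.
have le_cst j : (\int[lottery M I]_(o in [set j] `*` `[0%R, 1%R])
    (welfare I o.1 o.2)%:E <=
    (h j)%:E * lottery M I ([set j] `*` `[0%R, 1%R]))%E.
  rewrite -integral_cst //; apply: ge0_le_integral => //.
  - by move=> o [_ /=]; rewrite in_itv /= lee_fin => /welfare_ge0.
  - by move=> o [/= -> ]; rewrite in_itv /= lee_fin => /Wh.
exact: leeD.
Qed.

Lemma approx_ratio_ge (R : realType) (M : mechanism R) n (I : instance R n)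
    (w : R) :
  0 < w -> (expected_welfare M I <= w%:E)%E ->
  ((opt_welfare I / w)%:E <= approx_ratio M)%E.
Proof.
move=> w0 Ew.
apply: (@le_trans _ _ ((opt_welfare I)%:E / expected_welfare M I)%E); last first.
  by apply: ereal_sup_ubound; exists n, I.
have -> : (opt_welfare I / w)%:E = ((opt_welfare I)%:E * (w%:E)^-1)%E.
  by rewrite inver gt_eqF.
(* Inversion is antitone on all nonnegative extended reals, so a zero expected welfare, with inverse
   [+oo], needs no separate case. *)
apply: lee_pmul => //.
- rewrite lee_fin (le_trans _ (welfare_le_opt R n I false 0 _)) //.
    by rewrite welfare_ge0 // lexx ler01.
  by rewrite lexx ler01.
- by rewrite inve_ge0 lee_fin ltW.
- by rewrite lee_pV2 // inE ?expected_welfare_ge0 // lee_fin ltW.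
Qed.

(** The boolean [2 <= i] is itself the facility that agent [i] approves. The profile does not
    mention [b], so its lottery over facilities is fixed before [b] is chosen. *)
Definition split_profile : profile 4 := fun i j => (2 <= i)%N == j.

(** Each pair of approvers has one odd index: the approvers of [b] stand at 0 and 1, everyone else
    at 0. *)
Definition split_pos (R : realType) (b : facility) (i : 'I_4) : R :=
  (split_profile i b && odd i)%:R.

Lemma split_pos_itv (R : realType) b i : 0 <= split_pos R b i <= 1.
Proof. by rewrite /split_pos ler0n lern1 leq_b1. Qed.

Lemma split_profile_ex i : exists j, split_profile i j.
Proof. by exists (2 <= i)%N; rewrite /split_profile. Qed.

Definition split_instance (R : realType) (b : facility) : instance R 4 :=
  Instance (isT : 0 < 4)%N (split_pos_itv R b) split_profile_ex.

(** The distances from [y] to the two ends add up to 1. *)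
Lemma welfare_split_bad (R : realType) (b : facility) (y : R) :
  0 <= y <= 1 -> welfare (split_instance R b) b y = 1.
Proof.
move=> /andP[y0 y1].
rewrite /welfare !big_ord_recl big_ord0 /utility /= /split_pos /split_profile /=.
by case: b; rewrite /= !(mul0r, mul1r, sub0r, normrN) (ger0_norm y0)
  ger0_norm ?subr_ge0 //; ring.
Qed.

Lemma welfare_split_good (R : realType) (b : facility) (y : R) :
  0 <= y <= 1 -> welfare (split_instance R b) (~~ b) y = 2 * (1 - y).
Proof.
move=> /andP[y0 y1].
rewrite /welfare !big_ord_recl big_ord0 /utility /= /split_pos /split_profile /=.
by case: b; rewrite /= !(mul0r, mul1r, sub0r, normrN) (ger0_norm y0); ring.
Qed.

(** The two masses sum to 1, so one is at most 1/2; here [q] is the mass of the less likely facility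
    [~~ b]. *)
Lemma probability_bool_half (R : realType) (P : probability facility R) :
  exists b, exists2 q : R, q <= 2^-1 &
    P [set b] = (1 - q)%:E /\ P [set ~~ b] = q%:E.
Proof.
have E b : P [set ~~ b] = (1 - P [set b])%E.
  rewrite -probability_setC //; congr (P _).
  by apply/seteqP; split=> -[] /=; case: b => // /(_ erefl).
have [q Pq] : exists q : R, P [set true] = q%:E.
  by exists (fine (P [set true])); rewrite fineK // fin_num_measure.
have Pf : P [set false] = (1 - q)%:E by rewrite (E true) Pq.
have [qle|qgt] := leP q (2^-1); first by exists false, q.
by exists true, (1 - q); [lra | rewrite Pf Pq subKr].
Qed.

Theorem theorem4p5 (R : realType) (M : mechanism R) (hM : random_median M)
    (delta : R) (hdelta : 0 < delta) :
  ((4%:R / 3%:R - delta)%:E <= approx_ratio M)%E.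
Proof.
have [p [right [d [_ lotE]]]] := hM.
have [b [q q_half [pb pnb]]] := probability_bool_half R (p 4 split_profile).
pose I := split_instance R b.
have lot_le j : (lottery M I ([set j] `*` `[0%R, 1%R]) <=
                 p 4%N split_profile [set j])%E.
  (* The preimage of the strip lies inside [[set j]], wherever the median is. *)
  rewrite lotE; last exact: measurableX.
  by apply: (le_measure (p 4 split_profile)); rewrite ?inE //= => k [].
have welfare_le j y : 0 <= y <= 1 -> welfare I j y <= (if j == b then 1 else 2).
  move=> y01; have [->|jb] := eqVneq j b; first by rewrite welfare_split_bad.
  have -> : j = ~~ b by case: (j) (b) jb => -[].
  by rewrite welfare_split_good //; lra.
have Ele : (expected_welfare M I <= (3 / 2 : R)%:E)%E.
  apply: le_trans (expected_welfare_le R M 4 I _ b welfare_le) _.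
  have -> : (~~ b == b) = false by case: (b).
  rewrite eqxx mul1e.
  (* The bound becomes [1 + q], which is at most 3/2. *)
  apply: (@le_trans _ _ ((1 - q)%:E + 2%:E * q%:E)%E).
    by rewrite leeD // -?pb -?pnb ?lee_pmul2l ?lee_fin // lot_le.
  by rewrite -EFinM -EFinD lee_fin; lra.
have opt_ge : 2 <= opt_welfare I.
  have y01 : 0 <= (0 : R) <= 1 by rewrite lexx ler01.
  (* Location 0 is where both approvers of [~~ b] stand. *)
  apply: le_trans (welfare_le_opt R 4 I (~~ b) 0 y01).
  by rewrite welfare_split_good // subr0 mulr1.
apply: le_trans (approx_ratio_ge R M 4 I _ _ Ele); last by lra.
by rewrite lee_fin; lra.
Qed.
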